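(* For every point-line geometry $\Gamma$ (not necessarily satisfying the Exchange Property), $\mathrm{rk}_{\mathrm{gen}}(\Gamma)\leq\mathrm{rk}_{\mathrm{WO}}(\Gamma)$.
   Context: A point-line geometry is a pair $\Gamma=(P,\mathcal{L})$ where $P$ (points) is a non-empty set and $\mathcal{L}$ (lines) is a family of subsets of $P$, each containing at least two points. A subspace of $\Gamma$ is a subset $S\subseteq P$ such that every line meeting $S$ in at least two points is contained in $S$ (so $\emptyset$ and $P$ are subspaces). For $X\subseteq P$, $\langle X\rangle$ is the smallest subspace containing $X$. Exchange Property: for all $X\subseteq P$ and $x,y\in P$, if $y\in\langle X\cup\{x\}\rangle$ but $y\notin\langle X\rangle$, then $x\in\langle X\cup\{y\}\rangle$. The generating rank is $\mathrm{rk}_{\mathrm{gen}}(\Gamma):=\min\{|X| : X\subseteq P,\ \langle X\rangle=P\}$. A chain of subspaces is a (non-empty) set $\mathcal{C}$ of subspaces totally ordered by inclusion; its length is $\ell(\mathcal{C}):=|\mathcal{C}|-1$, with $|\mathcal{C}|-1=|\mathcal{C}|$ if $|\mathcal{C}|$ is infinite. $\mathfrak{W}(\Gamma)$ is the family of all chains of subspaces of $\Gamma$ that are well ordered by inclusion, and $\mathrm{rk}_{\mathrm{WO}}(\Gamma):=\sup\{\ell(\mathcal{C}) : \mathcal{C}\in\mathfrak{W}(\Gamma)\}$ (supremum of cardinals). *)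

(* Defs.v *)
From HB Require Import structures.
From mathcomp Require Import all_boot all_order finmap.
From mathcomp Require Import boolp classical_sets functions cardinality.

Set Implicit Arguments.
Unset Strict Implicit.
Unset Printing Implicit Defensive.

Import Order.TTheory.

Local Open Scope classical_set_scope.
Local Open Scope card_scope.

(* A cardinal is an equivalence class of types modulo equinumerosity.         *)
Record cardinal := Cardinal {
  cardinal_class : set Type;
  cardinal_classP :
    exists T : Type, cardinal_class = [set U | [set: U] #= [set: T]] }.

(* [{x | A x}] rather than [set_type A]: the latter lives in a universe that is
   too large to also form [set cardinal].                                     *)
Lemma card_setT_sig (T : Type) (A : set T) : [set: {x | A x}] #= A.
Proof.
have AE : A = @sval T A @` setT.
  by apply/seteqP; split=> [x Ax|_ [[x Ax] _ <-]//]; exists (exist _ x Ax).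
apply/card_esym; rewrite [X in X #= _]AE.
apply: inj_card_eq => -[x Ax] [y Ay] _ _ /= xy; subst y.
by congr exist; exact: Prop_irrelevance.
Qed.

Lemma cardinality_subproof (T : Type) (A : set T) :
  exists U : Type, [set V : Type | [set: V] #= A] = [set V | [set: V] #= [set: U]].
Proof.
exists {x | A x}; apply/funext => V /=; congr is_true.
by rewrite (card_eqr (card_setT_sig A)).
Qed.

Definition cardinality (T : Type) (A : set T) : cardinal :=
  Cardinal (cardinality_subproof A).

Definition cardinal_le (k l : cardinal) : bool :=
  `[< exists T U : Type, [/\ cardinal_class k T, cardinal_class l U &
                             [set: T] #<= [set: U]] >].

Lemma cardinal_eq (k l : cardinal) : cardinal_class k = cardinal_class l -> k = l.
Proof.
by case: k l => [K pK] [L pL] /= KL; subst L; congr Cardinal; exact: Prop_irrelevance.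
Qed.

Lemma cardinality_surj (k : cardinal) : exists T : Type, k = cardinality [set: T].
Proof. by have [T kT] := cardinal_classP k; exists T; apply: cardinal_eq. Qed.

Lemma cardinal_leE (T U : Type) (A : set T) (B : set U) :
  cardinal_le (cardinality A) (cardinality B) = (A #<= B).
Proof.
apply/asboolP/idP => /= [[V [W [VA WB]]]|AB].
  by rewrite (card_le_eql VA) (card_le_eqr WB).
exists {x | A x}, {x | B x}; split; [exact: card_setT_sig..|].
by rewrite (card_le_eql (card_setT_sig A)) (card_le_eqr (card_setT_sig B)).
Qed.

Lemma cardinality_eq (T U : Type) (A : set T) (B : set U) :
  (cardinality A = cardinality B) <-> (A #= B).
Proof.
split=> [AB|AB].
  by apply/card_eqPle; split; rewrite -cardinal_leE AB cardinal_leE.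
apply: cardinal_eq; apply/funext => V /=; congr is_true.
by rewrite (card_eqr AB).
Qed.

HB.instance Definition _ := gen_eqMixin cardinal.
HB.instance Definition _ := gen_choiceMixin cardinal.

Lemma cardinal_le_refl : reflexive cardinal_le.
Proof. by move=> k; have [T ->] := cardinality_surj k; rewrite cardinal_leE. Qed.

Lemma cardinal_le_anti : antisymmetric cardinal_le.
Proof.
move=> k l; have [T ->] := cardinality_surj k; have [U ->] := cardinality_surj l.
by rewrite !cardinal_leE => /andP[TU UT]; apply/cardinality_eq/card_eqPle.
Qed.

Lemma cardinal_le_trans : transitive cardinal_le.
Proof.
move=> l k m; have [T ->] := cardinality_surj k.
have [U ->] := cardinality_surj l; have [V ->] := cardinality_surj m.
by rewrite !cardinal_leE; exact: card_le_trans.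
Qed.

Fact cardinal_display : Order.disp_t. Proof. exact: Order.Disp tt tt. Qed.

HB.instance Definition _ := Order.Le_isPOrder.Build cardinal_display cardinal
  cardinal_le_refl cardinal_le_anti cardinal_le_trans.

Lemma le_cardinality (T U : Type) (A : set T) (B : set U) :
  (cardinality A <= cardinality B)%O = (A #<= B).
Proof. exact: cardinal_leE. Qed.

Lemma ex_min_card (I : Type) (i0 : I) (X : I -> Type) :
  exists i, forall j, [set: X i] #<= [set: X j].
Proof.
pose inj (F : set (forall i, X i)) :=
  forall i x y, F x -> F y -> x i = y i -> x = y.
have [|F [Finj Fmax]] := @Zorn_bigcup _ [set F | inj F].
  move=> C CP Ctot i x y [F CF Fx] [G CG Gy] xy.
  have [FG|GF] := Ctot _ _ CF CG.
    exact: (CP _ CG i) (FG _ Fx) Gy xy.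
  exact: (CP _ CF i) Fx (GF _ Gy) xy.
have [[i Fi]|noF] := pselect (exists i, forall a, exists2 x, F x & x i = a).
  have /(_ _)/cid2-/all_sig[g gP] := Fi.
  exists i => j; apply/card_leP.
  suff : exists2 f : X i -> X j, set_fun setT setT f & set_inj setT f.
    by move/injfunPex => [f]; squash (to_setT \o f \o set_val).
  exists (fun a => g a j) => // a b _ _ /= gab.
  have [Fa <-] := gP a; have [Fb <-] := gP b.
  by rewrite (Finj _ _ _ Fa Fb gab).
have /(_ _)/cid-/all_sig[f fP] : forall i, exists a, forall x, F x -> x i <> a.
  move=> i; apply: contrapT => na; apply: noF; exists i => a.
  apply: contrapT => nx; apply: na; exists a => x Fx xa.
  by apply: nx; exists x.
exfalso; apply: (Fmax (F `|` [set f])).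
  split; first by move=> x Fx; left.
  by move=> /(_ f (or_intror erefl)) Ff; exact: (fP i0 f Ff).
move=> i x y [Fx|->] [Fy|->] //; first exact: Finj.
  by move/fP => /(_ Fx).
by move=> /esym/fP => /(_ Fy).
Qed.

Lemma cardinal_ex_min (K : set cardinal) : K !=set0 -> K `&` lbound K !=set0.
Proof.
move=> [k0 Kk0].
have /(_ _)/cid-/all_sig[X XP] := cardinality_surj.
have [[k Kk] kmin] := @ex_min_card {k | K k} (exist _ k0 Kk0) (X \o sval).
exists k; split=> // l Kl.
by rewrite (XP k) (XP l) le_cardinality;
  exact: (kmin (exist _ l Kl)).
Qed.

Lemma cardinal_le_total : total (<=%O : rel cardinal).
Proof.
move=> k l; have [|m [[->|->] mP]] := @cardinal_ex_min [set k; l].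
- by exists k; left.
- by rewrite mP //; right.
- by rewrite orbC mP //; left.
Qed.

HB.instance Definition _ :=
  Order.POrder_isTotal.Build cardinal_display cardinal cardinal_le_total.

Definition cardinal_nat (n : nat) : cardinal := cardinality `I_n.

(* The default value [cardinal_nat 0] is only reached when K is empty for     *)
(* [cardinal_min] and when K is empty or unbounded for [cardinal_sup].        *)
Definition cardinal_min (K : set cardinal) : cardinal :=
  xget (cardinal_nat 0) (K `&` lbound K).

Definition cardinal_sup (K : set cardinal) : cardinal :=
  supremum (cardinal_nat 0) K.

Lemma cardinal_minP (K : set cardinal) :
  K !=set0 -> K (cardinal_min K) /\ lbound K (cardinal_min K).
Proof. by move=> /cardinal_ex_min; exact: xgetPex. Qed.

Lemma cardinal_supP (K : set cardinal) :
  has_ubound K -> isLub K (cardinal_sup K).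
Proof.
move=> Kub; rewrite /cardinal_sup /supremum; case: ifPn => [/eqP ->|K0].
  split=> // b _; have [T ->] := cardinality_surj b.
  by rewrite /cardinal_nat II0 le_cardinality.
by have [] := xgetPex (cardinal_nat 0) (cardinal_ex_min Kub).
Qed.

Record point_line_geometry := PointLineGeometry {
  point :> Type;
  line : set (set point);
  point_nonempty : [set: point] !=set0;
  line_two_points : forall L, line L -> exists x y, [/\ L x, L y & x <> y] }.

Section Geometry.
Variable G : point_line_geometry.
Implicit Types (S X : set G) (C : set (set G)).

Definition subspace S : Prop :=
  forall L, line L -> (exists x y, [/\ L x, L y, S x, S y & x <> y]) -> L `<=` S.

Definition span X : set G := smallest subspace X.

Definition generates X : Prop := span X = setT.

Definition rk_gen : cardinal :=
  cardinal_min [set cardinality X | X in generates].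

Definition subspace_chain C : Prop :=
  [/\ C !=set0, C `<=` subspace & total_on C subset].

Definition well_ordered C : Prop :=
  forall D, D `<=` C -> D !=set0 -> exists2 M, D M & forall S, D S -> M `<=` S.

(* [G -> Prop] instead of [set G] in [@cardinality (G -> Prop) C], again for  *)
(* universe reasons.                                                          *)
Definition chain_length C : cardinal :=
  if `[< finite_set C >] then cardinal_nat (#|` fset_set C|%fset).-1
  else @cardinality (G -> Prop) C.

Definition wo_chains : set (set (set G)) :=
  [set C | subspace_chain C /\ well_ordered C].

Definition rk_WO : cardinal := cardinal_sup [set chain_length C | C in wo_chains].

Lemma span_subspace X : subspace (span X).
Proof.
move=> L lL [x [y [Lx Ly Sx Sy xy]]] z Lz S [sS XS].
apply: (sS L lL); last exact: Lz.
by exists x, y; split; [| | exact: Sx | exact: Sy |].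
Qed.

Lemma generatesT : generates setT.
Proof. by apply/smallest_id => L _ _ x. Qed.

Lemma rk_genP :
  (exists2 X, generates X & rk_gen = cardinality X) /\
  (forall X, generates X -> (rk_gen <= cardinality X)%O).
Proof.
rewrite /rk_gen; have [|[X gX XE] min] := @cardinal_minP [set cardinality X | X in generates].
  by exists (cardinality [set: G]); exists setT => //; exact: generatesT.
by split=> [|Y gY]; [exists X | apply: min; exists Y].
Qed.

Lemma chain_length_le C : (chain_length C <= @cardinality (G -> Prop) C)%O.
Proof.
rewrite /chain_length; case: asboolP => [fC|//].
have [n Cn] := fC; rewrite (card_fset_set Cn) le_cardinality.
by rewrite (card_le_eqr Cn) card_le_II leq_pred.
Qed.

Lemma rk_WO_lub : isLub [set chain_length C | C in wo_chains] rk_WO.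
Proof.
apply: cardinal_supP; exists (cardinality [set: G -> Prop]) => _ [C _ <-].
by apply: le_trans (chain_length_le C) _; rewrite le_cardinality card_leT.
Qed.

End Geometry.

Arguments rk_gen : clear implicits.
Arguments rk_WO : clear implicits.

(* Main.v *)
(* Fix a well-order on the points, and let Y be the set of the points x that do
   not belong to the span S x of the points preceding x. By well-founded
   induction Y generates. The map S is strictly increasing on Y, since x belongs
   to S y but not to S x when x < y in Y, so the S x with x in Y, together with
   the whole space (which is none of them), form a well-ordered chain with one
   more element than Y. *)
Require Import Defs.
From mathcomp Require Import all_boot all_order.
From mathcomp Require Import finmap.
From mathcomp Require Import boolp wochoice classical_sets functions cardinality.

Set Implicit Arguments.
Unset Strict Implicit.
Unset Printing Implicit Defensive.

Import Order.TTheory.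

Local Open Scope classical_set_scope.
Local Open Scope card_scope.

Lemma well_order_type (T : Type) : exists R : rel T, well_order R.
Proof. by have [R Rwo] := @well_ordering_principle {classic T}; exists R. Qed.

Section WellOrder.
Variables (T : Type) (R : rel T).
Hypothesis Rwo : well_order R.

Lemma well_order_min (A : set T) :
  A !=set0 -> exists2 x, A x & forall y, A y -> R x y.
Proof.
move=> [a Aa]; have [|x [[xA minx] _]] := Rwo (A := mem A).
  by exists a; rewrite inE.
by exists x => [|y Ay]; [move: xA; rewrite inE | apply: minx; rewrite inE].
Qed.

Lemma well_order_total : total R.
Proof.
move=> x y; have [|z [->|->] zP] := @well_order_min [set x; y].
- by exists x; left.
- by rewrite zP //; right.
- by rewrite orbC zP //; left.
Qed.

Lemma well_order_refl : reflexive R.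
Proof. by move=> x; have := well_order_total x x; rewrite orbb. Qed.

(** Least elements are unique in a [well_order], and here both [x] and [y] are least in
    [[set x; y]]. *)
Lemma well_order_anti : antisymmetric R.
Proof.
move=> x y /andP[xy yx].
have [|z [_ zP]] := Rwo (A := mem [set x; y]); first by exists x; rewrite inE; left.
have zE t : [set x; y] t -> z = t.
  move=> At; apply: zP; split=> [|u]; rewrite inE //.
  by case: At => -> [] -> //; exact: well_order_refl.
by rewrite -(zE x) ?(zE y) //; [right|left].
Qed.

Lemma well_order_trans : transitive R.
Proof.
move=> y x z xy yz; have [|m mA mP] := @well_order_min [set x; y; z].
  by exists x; left; left.
have [mx my mz] : [/\ R m x, R m y & R m z].
  by split; apply: mP; [left; left|left; right|right].
(* If the least element is [x], then [R x z] is immediate; if it is [y] or [z], antisymmetry gives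
   [x = y] or [y = z]. *)
case: mA mx my mz => [[]|] -> mx my mz //.
  by rewrite (@well_order_anti x y) // xy.
by rewrite -(@well_order_anti y z) // yz.
Qed.

End WellOrder.

Lemma span_sub (G : point_line_geometry) (X Y : set G) :
  X `<=` span Y -> span X `<=` span Y.
Proof. by apply: smallest_sub; exact: span_subspace. Qed.

Lemma sub_span (G : point_line_geometry) (X : set G) : X `<=` span X.
Proof. exact: sub_gen_smallest. Qed.

Lemma subspaceT (G : point_line_geometry) : subspace (@setT G).
Proof. by move=> L _ _ x. Qed.

Lemma well_ordered_total (G : point_line_geometry) (C : set (set G)) :
  well_ordered C -> total_on C subset.
Proof.
move=> Cwo S T CS CT; have [|| M [->|->] MP] := Cwo [set S; T].
- by move=> _ [] ->.
- by exists S; left.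
- by left; apply: MP; right.
- by right; apply: MP; left.
Qed.

(** In the finite case the new element [S] makes up for the [.-1] in [chain_length]; in the infinite
    case nothing is subtracted and inclusion suffices. *)
Lemma chain_length_setU1 (G : point_line_geometry) (S : set G) (C : set (set G)) :
  ~ C S -> (@cardinality (G -> Prop) C <= chain_length (S |` C))%O.
Proof.
move=> nCS; rewrite /chain_length; case: asboolP => [fSC|_]; last first.
  by rewrite le_cardinality; apply: subset_card_le => T CT; right.
have fC : finite_set C by apply: sub_finite_set fSC => T CT; right.
rewrite fset_setU1 // cardfsU1 in_fset_set // memNset //=.
have [n Cn] := fC; rewrite (card_fset_set Cn) le_cardinality.
by rewrite add0n (card_le_eql Cn).
Qed.

Section GreedyChain.
Variables (G : point_line_geometry) (R : rel G).
Hypothesis Rwo : well_order R.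

(** For a well-order [R], [~~ R x y] says that [y] strictly precedes [x]. *)
Definition initial_span (x : G) : set G := span [set y | ~~ R x y].

Definition greedy_set : set G := [set x | ~ initial_span x x].

Definition greedy_chain : set (set G) := initial_span @` greedy_set.

Lemma initial_span_mono x y : R x y -> initial_span x `<=` initial_span y.
Proof.
move=> xy; apply: span_sub => z /= nxz; apply: sub_span => /=.
by apply: contra nxz; exact: (well_order_trans Rwo).
Qed.

Lemma greedy_set_generates : generates greedy_set.
Proof.
apply/seteqP; split=> // x _; apply: contrapT => nx.
have [|m /= nm mP] := @well_order_min _ _ Rwo (~` span greedy_set).
  by exists x.
(* If the least missing point [m] is not greedy, it lies in the span of its predecessors, which by
   minimality all lie in [span greedy_set]. *)
apply: nm; have [Ym|/contrapT mm] := pselect (greedy_set m); first exact: sub_span.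
apply: (span_sub _ mm) => y /= nmy; apply: contrapT => /mP my.
by rewrite my in nmy.
Qed.

Lemma initial_span_inj : set_inj greedy_set initial_span.
Proof.
(* Otherwise [x] strictly precedes [y], hence lies in [initial_span y = initial_span x], against
   greediness. *)
have lt x y : greedy_set x -> initial_span x = initial_span y -> R y x.
  move=> Yx xy; case: (boolP (R y x)) => // nyx; case: Yx.
  by rewrite xy; exact: sub_span.
move=> x y; rewrite !inE => Yx Yy xy.
by apply: (well_order_anti Rwo); rewrite !lt.
Qed.

Lemma greedy_chainNT : ~ greedy_chain setT.
Proof. by move=> [x nx xT]; apply: nx; rewrite xT. Qed.

Lemma greedy_chain_wo : wo_chains (setT |` greedy_chain).
Proof.
have Cwo : well_ordered (setT |` greedy_chain).
  move=> D DC [S DS].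
  (* Either [setT] is the only member of [D], or the least index [x] with [initial_span x] in [D]
     gives the least member by monotonicity. *)
  have [[x0 Dx0]|nD] := pselect (exists x, D (initial_span x)); last first.
    exists S => // T DT; have [->//|[x _ xT]] := DC _ DT.
    by case: nD; exists x; rewrite xT.
  have [|x Dx xP] := @well_order_min _ _ Rwo [set x | D (initial_span x)].
    by exists x0.
  exists (initial_span x) => // T DT; have [->//|[y _ yT]] := DC _ DT.
  by rewrite -yT; apply: initial_span_mono; apply: xP; rewrite /= yT.
split=> //; split; last exact: well_ordered_total.
  by exists setT; left.
by move=> _ [->|[x _ <-]]; [exact: subspaceT | exact: span_subspace].
Qed.

Lemma greedy_chain_length :
  (cardinality greedy_set <= chain_length (setT |` greedy_chain))%O.
Proof.
apply: le_trans (chain_length_setU1 greedy_chainNT).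
by rewrite le_cardinality (card_le_eqr (inj_card_eq initial_span_inj)).
Qed.

End GreedyChain.

Theorem theorem1p4 (G : point_line_geometry) : (rk_gen G <= rk_WO G)%O.
Proof.
have [R Rwo] := well_order_type G.
have [_ rk_le] := rk_genP G; have [rk_ub _] := rk_WO_lub G.
apply: le_trans (rk_le _ (greedy_set_generates Rwo)) _.
apply: le_trans (greedy_chain_length Rwo) (rk_ub _ _).
by exists (setT |` greedy_chain R) => //; exact: greedy_chain_wo.
Qed.
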